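(* Let $\boldsymbol{f}$ be a continuous function on $[0,1]^d$, and suppose that $\boldsymbol{f}$ admits a representation $$\boldsymbol{f}=(\boldsymbol{\Phi}_1\circ\boldsymbol{\Phi}_0)\boldsymbol{x}.$$ For any $k,G\in\mathbb{N}^+$, there exists a function $\boldsymbol{\phi}(\boldsymbol{x})=(\boldsymbol{\Phi}_1^{G}\circ\boldsymbol{\Phi}_0^{G})\boldsymbol{x}$, implemented by a two-layer B-spline KAN with degree $k$ of the piecewise B-spline polynomial and number of knots $G$, where $P=G+k-1$ is the number of B-spline basis functions used for each activation function. Let $\mathcal{A}$ be the set of functions computed by this network. The best approximation error $\varepsilon_{\alpha,d}(\mathcal{A})$ for functions in $H_1(C^\alpha([0,1]^d))$, when approximated by elements of $\mathcal{A}$, has a lower bound such that $$\varepsilon_{\alpha,d}(\mathcal{A})\ \ge\ C\Bigl(NP(d+1)(d+N+1)\log\bigl((d+1)P\bigr)\Bigr)^{-\alpha/d},$$ where $C$ is a constant, $d$ denotes the dimension of the input vector, and $N$ represents the number of basis functions in the second layer of the two-layer B-spline KAN.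
   Context: Two-layer representation: $(\boldsymbol{\Phi}_1\circ\boldsymbol{\Phi}_0)\boldsymbol{x}=\sum_{j=1}^{N}\phi_{1,j}\bigl(\sum_{i=1}^{d}\phi_{0,j,i}(x_i)\bigr)$ for $\boldsymbol{x}=(x_1,\ldots,x_d)\in[0,1]^d$, where the $\phi_{0,j,i}$ (inner functions, forming $\boldsymbol{\Phi}_0$) and $\phi_{1,j}$ (outer functions, forming $\boldsymbol{\Phi}_1$) are functions of one variable. Two-layer B-spline KAN (Kolmogorov–Arnold network): $(\boldsymbol{\Phi}_1^{G}\circ\boldsymbol{\Phi}_0^{G})\boldsymbol{x}=\sum_{j=1}^{N}\phi^{G}_{1,j}\bigl(\sum_{i=1}^{d}\phi^{G}_{0,j,i}(x_i)\bigr)$, where each univariate activation function $\phi^G_{0,j,i},\phi^G_{1,j}$ is a linear combination, with trainable real coefficients, of the degree-$k$ B-spline basis functions for the given knots ($P$ of them per activation function). The network has $(dN+N)P$ parameters and is counted as having $d+N+1$ units. B-splines: for knots $x_i$, $B_{i,0}(x)=1$ if $x_i\le x<x_{i+1}$ and $0$ otherwise, and $B_{i,k}(x)=\frac{x-x_i}{x_{i+k}-x_i}B_{i,k-1}(x)+\frac{x_{i+k+1}-x}{x_{i+k+1}-x_{i+1}}B_{i+1,k-1}(x)$. Hölder class: for $E\subseteq\mathbb{R}^d$, $\lambda>0$ and $\alpha\in(0,1]$, $H_\lambda(C^\alpha(E))$ is the set of $f:E\to\mathbb{R}$ with $|f(\boldsymbol{x})-f(\boldsymbol{y})|\le\lambda\|\boldsymbol{x}-\boldsymbol{y}\|^\alpha$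 for all $\boldsymbol{x},\boldsymbol{y}\in E$, with $\|\cdot\|$ the Euclidean norm. Best approximation error: $\varepsilon_{\alpha,d}(\mathcal{A}):=\sup_{f\in H_1(C^\alpha([0,1]^d))}\ \inf_{\phi\in\mathcal{A}}\|\phi-f\|_{L^\infty([0,1]^d)}$. *)

(* Defs.v *)
From HB Require Import structures.
From mathcomp Require Import all_boot all_order all_algebra.
From mathcomp Require Import all_classical all_reals all_analysis.

Set Implicit Arguments.
Unset Strict Implicit.
Unset Printing Implicit Defensive.

Import Order.TTheory GRing.Theory Num.Theory.
Import numFieldNormedType.Exports.

Local Open Scope classical_set_scope.
Local Open Scope ring_scope.

Definition cube (R : realType) (d : nat) : set 'rV[R]_d :=
  [set x | forall i, 0 <= x 0 i <= 1].
Arguments cube : clear implicits.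

(* The library's norm on 'rV[R]_d is the max norm. *)
Definition enorm (R : realType) (d : nat) (x : 'rV[R]_d) : R :=
  Num.sqrt (\sum_(i < d) x 0 i ^+ 2).

Definition two_layer (R : realType) (d N : nat)
    (phi0 : 'I_N -> 'I_d -> R -> R) (phi1 : 'I_N -> R -> R)
    (x : 'rV[R]_d) : R :=
  \sum_(j < N) phi1 j (\sum_(i < d) phi0 j i (x 0 i)).

(* Cox-de Boor recursion. Where knots coincide, x / 0 = 0 gives the usual
   convention for repeated knots. *)
Fixpoint bspline {R : realType} (t : seq R) (k i : nat) (x : R) : R :=
  if k is k'.+1 then
    (x - t`_i) / (t`_(i + k) - t`_i) * bspline t k' i x
    + (t`_(i + k).+1 - x) / (t`_(i + k).+1 - t`_i.+1) * bspline t k' i.+1 x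
  else if t`_i <= x < t`_i.+1 then 1 else 0.

(* A grid of G knots is extended by k knots on each side; the resulting
   G + 2k knots carry G + 2k - (k + 1) = G + k - 1 B-splines of degree k. *)
Definition bspline_comb (R : realType) (k G : nat) (t : (G + k.*2).-tuple R) :
    set (R -> R) :=
  [set g | exists c : 'I_(G + k - 1) -> R,
     forall x, g x = \sum_(p < G + k - 1) c p * bspline t k p x].

(* The knots are fixed, one knot vector per activation function; only the
   coefficients vary. *)
Definition kan (R : realType) (d N k G : nat)
    (t0 : 'I_N -> 'I_d -> (G + k.*2).-tuple R)
    (t1 : 'I_N -> (G + k.*2).-tuple R) : set ('rV[R]_d -> R) :=
  [set phi | exists phi0 phi1,
    [/\ forall j i, bspline_comb (t0 j i) (phi0 j i),
        forall j, bspline_comb (t1 j) (phi1 j) &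
        phi = two_layer phi0 phi1]].

Definition holder (R : realType) (d : nat) (lambda alpha : R)
    (E : set 'rV[R]_d) : set ('rV[R]_d -> R) :=
  [set f | forall x y, E x -> E y ->
     `|f x - f y| <= lambda * enorm (x - y) `^ alpha].

(* d-dimensional Lebesgue outer measure: infimum of the total volume of the
   countable covers by closed boxes. *)
Definition lebesgue_outer (R : realType) (d : nat) (A : set 'rV[R]_d) : \bar R :=
  ereal_inf [set s | exists a b : nat -> 'rV[R]_d,
    [/\ forall n i, a n 0 i <= b n 0 i,
        forall x, A x -> exists n, forall i, a n 0 i <= x 0 i <= b n 0 i &
        s = (\sum_(0 <= n <oo) (\prod_(i < d) (b n 0 i - a n 0 i))%:E)%E]].

(* Essential supremum of |g| over E for the Lebesgue measure. *)
Definition Linfty_norm (R : realType) (d : nat) (E : set 'rV[R]_d)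
    (g : 'rV[R]_d -> R) : \bar R :=
  ereal_inf [set M : \bar R |
    lebesgue_outer [set x | E x /\ (M < `|g x|%:E)%E] = 0%E].

Definition best_approx_error (R : realType) (d : nat) (alpha : R)
    (A : set ('rV[R]_d -> R)) : \bar R :=
  ereal_sup [set ereal_inf [set Linfty_norm (cube R d) (phi \- f) | phi in A]
            | f in holder 1 alpha (cube R d)].

(* Main.v *)
Require Import Defs.
From mathcomp Require Import all_boot all_order all_algebra.
From mathcomp Require Import all_classical all_reals all_analysis.
From mathcomp Require Import measurable_realfun.
From mathcomp Require Import zify ring lra.

(* If every sign pattern of small bumps centred in the cells of an [m ^ d] grid
   is approximated to within the bump height, then the network shatters [m ^ d]
   points. The sides of the spline knots on which the inner sums fall at these
   points take few patterns, and with such a pattern fixed the outputs are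
   polynomials of degree [k + 1] in the coefficients. The sign patterns of
   finitely many polynomials are counted by attaching to each pattern a critical
   point of the product of their squares minus a small multiple of a high even
   power: these points solve a system [x i ^+ n = q i x] with [deg (q i) < n],
   which has at most [n] to the number of variables solutions. *)

Set Implicit Arguments.
Unset Strict Implicit.
Unset Printing Implicit Defensive.

Import Order.TTheory GRing.Theory Num.Theory.
Import numFieldNormedType.Exports.

Local Open Scope classical_set_scope.
Local Open Scope ring_scope.

(** * Polynomial functions and their sign patterns *)

Section PolynomialFunctions.
Variables (R : realType) (I : finType).
Implicit Types (x : I -> R) (f g : (I -> R) -> R) (e : I -> nat) (D : nat).

Definition monomial_fun e x : R := \prod_i x i ^+ e i.

(** Total degree at most [D], encoded as the linear span of the monomials of that degree or less, so
    that linear facts follow by induction from the case of one monomial. *)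
Inductive polyfun D : ((I -> R) -> R) -> Prop :=
| PolyMon e : (\sum_i e i <= D)%N -> polyfun D (monomial_fun e)
| Poly0 : polyfun D (fun=> 0)
| PolyLin a f g :
    polyfun D f -> polyfun D g -> polyfun D (fun x => a * f x + g x).

Lemma eq_polyfun D f g : f =1 g -> polyfun D f -> polyfun D g.
Proof. by move=> /funext ->. Qed.

Lemma polyfunW D E f : (D <= E)%N -> polyfun D f -> polyfun E f.
Proof.
move=> DE; elim=> [e eD||a {}f g _ pf _ pg]; first exact/PolyMon/(leq_trans eD).
- exact: Poly0.
- exact: PolyLin.
Qed.

Lemma polyfunD D f g :
  polyfun D f -> polyfun D g -> polyfun D (fun x => f x + g x).
Proof.
move=> pf pg; apply: eq_polyfun (PolyLin 1 pf pg) => x.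
by rewrite mul1r.
Qed.

Lemma polyfunZ D a f : polyfun D f -> polyfun D (fun x => a * f x).
Proof.
move=> pf; apply: eq_polyfun (PolyLin a pf (Poly0 D)) => x.
by rewrite addr0.
Qed.

Lemma polyfunM D E f g :
  polyfun D f -> polyfun E g -> polyfun (D + E) (fun x => f x * g x).
Proof.
move=> pf pg; elim: pf => [e eD||a f1 f2 _ p1 _ p2].
- elim: pg => [e' eE||a g1 g2 _ p1 _ p2].
  + apply: (@eq_polyfun _ (monomial_fun (fun i => e i + e' i)%N)).
      by move=> x; rewrite -big_split; apply: eq_bigr => i _; rewrite exprD.
    by apply: PolyMon; rewrite big_split leq_add.
  + by apply: eq_polyfun (Poly0 _) => x; rewrite mulr0.
  + by apply: eq_polyfun (PolyLin a p1 p2) => x; ring.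
- by apply: eq_polyfun (Poly0 _) => x; rewrite mul0r.
- by apply: eq_polyfun (PolyLin a p1 p2) => x; ring.
Qed.

Lemma polyfun_cst D a : polyfun D (fun=> a).
Proof.
have p1 : polyfun D (monomial_fun (fun=> 0%N)) by apply: PolyMon; rewrite big1.
apply: eq_polyfun (polyfunZ a p1) => x.
by rewrite /monomial_fun big1 ?mulr1.
Qed.

Lemma polyfun_coord i : polyfun 1 (fun x => x i).
Proof.
apply: (@eq_polyfun _ (monomial_fun (fun j => j == i))).
  move=> x; rewrite /monomial_fun (bigD1 i)//= eqxx expr1 big1 ?mulr1// => j.
  by move=> /negPf ->.
by apply: PolyMon; rewrite (bigD1 i)//= eqxx big1// => j /negPf ->.
Qed.

Lemma polyfun_sum D (J : Type) (r : seq J) (F : J -> (I -> R) -> R) :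
  (forall j, polyfun D (F j)) -> polyfun D (fun x => \sum_(j <- r) F j x).
Proof.
move=> pF; elim: r => [|j r IH].
  by apply: eq_polyfun (Poly0 D) => x; rewrite big_nil.
by apply: eq_polyfun (polyfunD (pF j) IH) => x; rewrite big_cons.
Qed.

Lemma polyfunX D n f : polyfun D f -> polyfun (n * D) (fun x => f x ^+ n).
Proof.
move=> pf; elim: n => [|n IH]; first exact: polyfun_cst.
by rewrite mulSn; apply: eq_polyfun (polyfunM pf IH) => x; rewrite exprS.
Qed.

Lemma polyfun_prod D (J : finType) (F : J -> (I -> R) -> R) :
  (forall j, polyfun D (F j)) -> polyfun (#|J| * D) (fun x => \prod_j F j x).
Proof.
move=> pF; rewrite cardE.
suff H r : polyfun (size r * D) (fun x => \prod_(j <- r) F j x).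
  by apply: eq_polyfun (H (enum J)) => x; rewrite big_enum.
elim: r => [|j r IH].
  by apply: eq_polyfun (polyfun_cst _ 1) => x; rewrite big_nil.
by apply: eq_polyfun (polyfunM (pF j) IH) => x; rewrite big_cons.
Qed.

Lemma polyfun_horner D (p : {poly R}) f :
  polyfun D f -> polyfun ((size p).-1 * D) (fun x => p.[f x]).
Proof.
move=> pf; apply: (@eq_polyfun _ (fun x => \sum_(i < size p) p`_i * f x ^+ i)).
  by move=> x; rewrite horner_coef.
apply: polyfun_sum => i; apply: polyfunZ.
apply: polyfunW (polyfunX i pf); rewrite leq_mul2r; apply/orP; right.
by case: (size p) i => [[]//|n] i; rewrite -ltnS.
Qed.

Definition upd x i (t : R) : I -> R := fun j => if j == i then t else x j.

Lemma monomial_upd e x i t :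
  monomial_fun e (upd x i t) = t ^+ e i * \prod_(j | j != i) x j ^+ e j.
Proof.
rewrite /monomial_fun (bigD1 i)//= /upd eqxx; congr (_ * _).
by apply: eq_bigr => j /negPf ->.
Qed.

Lemma polyfun_derive D g i : polyfun D g ->
  exists2 g', polyfun D g' &
    forall x, is_derive (x i) 1 (fun t => g (upd x i t)) (g' x).
Proof.
elim=> [e eD||a f1 f2 _ [g1 p1 d1] _ [g2 p2 d2]].
(* For [e i = 0] the truncated predecessor does no harm: the coefficient [(e i)%:R] vanishes. *)
- pose e' j := if j == i then (e i).-1 else e j.
  exists (fun x => (e i)%:R * monomial_fun e' x).
    apply/polyfunZ/PolyMon; apply: leq_trans eD; apply: leq_sum => j _.
    by rewrite /e'; case: eqP => [->|//]; apply: leq_pred.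
  move=> x; pose c := \prod_(j | j != i) x j ^+ e j.
  have -> : (fun t => monomial_fun e (upd x i t)) =
      c *: (fun t : R => t ^+ e i).
    by apply/funext => t; rewrite monomial_upd mulrC.
  have -> : (e i)%:R * monomial_fun e' x =
      c *: ((e i)%:R * x i ^+ (e i).-1 *: 1).
    rewrite /monomial_fun (bigD1 i)//= {1}/e' eqxx.
    have -> : \prod_(j | j != i) x j ^+ e' j = c.
      by apply: eq_bigr => j /negPf ji; rewrite /e' ji.
    by rewrite /GRing.scale/=; ring.
  apply: is_deriveZ.
  have -> : (fun t : R => t ^+ e i) = (id : R -> R) ^+ e i.
    by apply/funext => t; rewrite exprfctE.
  exact: is_deriveX.
- exists (fun=> 0); first exact: Poly0.
  by move=> x; apply: is_derive_cst.
- exists (fun x => a * g1 x + g2 x); first exact: PolyLin.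
  by move=> x; apply: is_deriveD.
Qed.

(** Lets a penalty of higher degree dominate [g] far from the origin. *)
Lemma polyfun_growth D g : polyfun D g ->
  exists2 A : R, 0 <= A & forall x rho, 1 <= rho -> (forall i, `|x i| <= rho) ->
    `|g x| <= A * rho ^+ D.
Proof.
elim=> [e eD||a f1 f2 _ [A1 A10 h1] _ [A2 A20 h2]].
- exists 1 => // x rho r1 xr; rewrite mul1r normr_prod.
  apply: (@le_trans _ _ (\prod_i rho ^+ e i)).
    apply: ler_prod => i _; rewrite normr_ge0 normrX /=.
    by apply: lerXn2r => //; rewrite nnegrE//; lra.
  by rewrite -expr_sum ler_weXn2l.
- by exists 0 => // x rho _ _; rewrite normr0 mul0r.
- exists (`|a| * A1 + A2); first by rewrite addr_ge0 ?mulr_ge0.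
  move=> x rho r1 xr; rewrite mulrDl; apply: le_trans (ler_normD _ _) _.
  rewrite lerD ?h2// normrM -mulrA ler_wpM2l// h1//.
Qed.

(** Continuity and compactness are used on row vectors, so functions on [I -> R] are transported
    there. *)
Definition of_row (z : 'rV[R]_#|I|) : I -> R := fun i => z 0 (enum_rank i).

Lemma polyfun_continuous D g : polyfun D g -> continuous (g \o of_row).
Proof.
elim=> [e eD||a f1 f2 _ c1 _ c2].
- move=> z; apply: (@cvg_big R I _ 1 _ mul_continuous _ (nbhs z)) => i _.
  apply: (@continuous_comp _ _ _ (fun w : 'rV[R]_#|I| => w 0 (enum_rank i))
      (fun t : R => t ^+ e i)); last exact: exprn_continuous.
  exact: coord_continuous.
- exact: cst_continuous.
- move=> z; apply: (@continuousD _ _ _ (fun w => a * (f1 \o of_row) w)).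
    by apply: (@continuousM _ _ (fun=> a)); [exact: cst_continuous|exact: c1].
  exact: c2.
Qed.

End PolynomialFunctions.

(** * Counting the solutions of a system [x i ^+ n.+1 = q i x] *)

Section Counting.
Variables (R : realType) (I : finType).

(** Division with remainder: a monomial with some exponent above [n] is rewritten by replacing
    [z i ^+ n.+1] with [q i z], which lowers the total degree by at least one. *)
Lemma polyfun_box_span n (q : I -> (I -> R) -> R) (Z : set (I -> R)) D g :
  (forall i, polyfun n (q i)) -> (forall z i, Z z -> z i ^+ n.+1 = q i z) ->
  polyfun D g ->
  exists a : {ffun I -> 'I_n.+1} -> R,
    forall z, Z z -> g z = \sum_e a e * monomial_fun (fun i => e i : nat) z.
Proof.
move=> pq Zq; elim/ltn_ind: D g => D IH g.
elim=> [e eD||b f1 f2 _ [a1 h1] _ [a2 h2]].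
- case: (boolP [forall i, (e i < n.+1)%N]) => [/forallP en|].
    pose e0 : {ffun I -> 'I_n.+1} := [ffun i => inord (e i)].
    exists (fun e' => (e' == e0)%:R) => z _.
    rewrite (bigD1 e0)//= eqxx mul1r big1 ?addr0 => [|e' /negPf ->]; last first.
      by rewrite mul0r.
    by apply: eq_bigr => i _; rewrite ffunE inordK.
  rewrite negb_forall => /existsP[i]; rewrite -leqNgt => ei.
  pose e' j := if j == i then (e i - n.+1)%N else e j.
  have ee' : (\sum_j e j = \sum_j e' j + n.+1)%N.
    rewrite (bigD1 i)//= [in RHS](bigD1 i)//= {1}/e' eqxx addnAC subnK//.
    by congr addn; apply: eq_bigr => j /negPf; rewrite /e' => ->.
  have p : polyfun (\sum_j e' j + n) (fun z => monomial_fun e' z * q i z).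
    by apply: polyfunM => //; apply: PolyMon.
  have [|a ha] := IH _ _ _ p; first by rewrite (leq_trans _ eD)// ee' addnS.
  exists a => z Zz; rewrite -ha// -Zq// /monomial_fun.
  rewrite (bigD1 i)//= [in RHS](bigD1 i)//= {1}/e' eqxx mulrAC -exprD subnK//.
  by congr (_ * _); apply: eq_bigr => j /negPf; rewrite /e' => ->.
- by exists (fun=> 0) => z _; rewrite big1// => e _; rewrite mul0r.
- exists (fun e => b * a1 e + a2 e) => z Zz; rewrite h1// h2// mulr_sumr.
  by rewrite -big_split; apply: eq_bigr => e _ /=; ring.
Qed.

(** Lagrange interpolation: each other point contributes an affine function of one coordinate that
    is 1 at [z t] and 0 at that point. *)
Lemma polyfun_separate (T : finType) (z : T -> I -> R) (t : T) :
  injective z ->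
  exists2 L : (I -> R) -> R,
    polyfun #|T| L & forall t', L (z t') = (t' == t)%:R.
Proof.
move=> zI.
have sep t' : exists l : (I -> R) -> R,
    [/\ polyfun 1 l, l (z t) = 1 & t' != t -> l (z t') = 0].
  have [->|tt'] := eqVneq t' t.
    by exists (fun=> 1); split=> //; exact: polyfun_cst.
  have [i zi] : exists i, z t' i != z t i.
    apply: contrapT => /forallNP H; case/negP: tt'; apply/eqP/zI/funext => i.
    by apply: contrapT => /eqP zz; apply: (H i).
  exists (fun x => (z t i - z t' i)^-1 * (x i + - z t' i)); split.
  - by apply/polyfunZ/polyfunD; [exact: polyfun_coord|exact: polyfun_cst].
  - by rewrite mulVf// subr_eq0 eq_sym.
  - by rewrite subrr mulr0.
have [l hl] := choice sep.
exists (fun x => \prod_t' l t' x).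
  by rewrite -[#|T|]muln1; apply: polyfun_prod => t'; have [] := hl t'.
move=> t'; have [->|tt'] := eqVneq t' t.
  by apply: big1 => t'' _; have [] := hl t''.
by rewrite (bigD1 t')//=; have [_ _ ->//] := hl t'; rewrite mul0r.
Qed.

(* The box monomials span all polynomial functions on the common zeros of the
   system [z i ^+ n.+1 = q i z], so there are at most as many such zeros. *)
Lemma leq_card_zeros n (q : I -> (I -> R) -> R)
    (T : finType) (z : T -> I -> R) :
  (forall i, polyfun n (q i)) -> (forall t i, z t i ^+ n.+1 = q i (z t)) ->
  injective z -> (#|T| <= n.+1 ^ #|I|)%N.
Proof.
move=> pq zq zI.
have zq' w i : range z w -> w i ^+ n.+1 = q i w by case=> t _ <-.
have H t : exists a : {ffun I -> 'I_n.+1} -> R, forall t',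
    \sum_e a e * monomial_fun (fun i => e i : nat) (z t') = (t' == t)%:R.
  have [L pL Lz] := polyfun_separate t zI.
  have [a ha] := polyfun_box_span pq zq' pL.
  by exists a => t'; rewrite -ha ?Lz//; exists t'.
have [a ha] := choice H.
(* Rows of [A] hold the box coefficients of the separating functions, columns of [M] the box
   monomials at the points. Their product is the identity, so its rank [#|T|] is at most the number
   of box monomials. *)
pose A := \matrix_(t < #|T|, e < #|{ffun I -> 'I_n.+1}|)
  a (enum_val t) (enum_val e).
pose M := \matrix_(e < #|{ffun I -> 'I_n.+1}|, t < #|T|)
  monomial_fun (fun i => (enum_val e : {ffun I -> 'I_n.+1}) i : nat)
    (z (enum_val t)).
have AM : A *m M = 1%:M.
  apply/matrixP => t t'; rewrite !mxE eq_sym -(inj_eq enum_val_inj) -ha.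
  rewrite (reindex (fun k : 'I_#|{ffun I -> 'I_n.+1}| => enum_val k)) /=;
    last exact/onW_bij/enum_val_bij.
  by apply: eq_bigr => e _; rewrite !mxE.
have := mulmx_max_rank A M; rewrite AM mxrank1 => /leq_trans; apply.
by rewrite card_ffun card_ord.
Qed.

Definition to_row (x : I -> R) : 'rV[R]_#|I| := \row_k x (enum_val k).

Lemma to_rowK : cancel to_row (@of_row R I).
Proof. by move=> x; apply/funext => i; rewrite /of_row mxE enum_rankK. Qed.

Lemma upd_same (x : I -> R) i : upd x i (x i) = x.
Proof. by apply/funext => j; rewrite /upd; case: eqP => [->|]. Qed.

Lemma upd_upd (x : I -> R) i s t : upd (upd x i s) i t = upd x i t.
Proof. by apply/funext => j; rewrite /upd; case: eqP. Qed.

Lemma finite_pos_lb (T : finType) (u : T -> R) :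
  (forall t, 0 < u t) -> exists2 eps, 0 < eps & forall t, eps < u t.
Proof.
(* The initial value 1 covers an empty [T]; halving [m] makes the bound strict. *)
move=> u0; pose m := \big[Num.min/1]_t u t.
have m0 : 0 < m.
  by rewrite /m; elim/big_ind: _ => // x y x0 y0; rewrite lt_min x0.
exists (m / 2); first by rewrite divr_gt0.
move=> t; apply: lt_le_trans (_ : m <= _); first by rewrite ltr_pdivrMr//; lra.
exact: bigmin_le_cond.
Qed.

End Counting.

(** * Counting sign patterns by critical points of a penalized product *)

Section SignPatterns.
Variables (R : realType) (I : finType).

(** If [rho] is the largest absolute coordinate, [P] is at most [A * rho ^+ m.*2] while the penalty
    is at least [eps * rho ^+ m.*2.+2]; the latter wins once [rho] reaches [1 + A / eps]. *)
Lemma penalized_bound (P : (I -> R) -> R) m eps :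
  polyfun m.*2 P -> 0 < eps ->
  exists B : R, forall x, 0 < P x - eps * \sum_i x i ^+ m.*2.+2 ->
    forall i, `|x i| < B.
Proof.
move=> /polyfun_growth[A A0 PA] eps0; exists (1 + A / eps) => x Hx i.
rewrite ltNge; apply/negP => xi.
pose k := [arg max_(k > i) `|x k|]%O; pose rho := `|x k|.
have xrho j : `|x j| <= rho.
  by rewrite /rho /k; case: arg_maxP => // k' _ /(_ j); apply.
have rhoB : 1 + A / eps <= rho by exact: le_trans xi _.
have Ae : 0 <= A / eps by rewrite divr_ge0// ltW.
have rho1 : 1 <= rho by lra.
have Pr := PA x rho rho1 xrho; have {}Pr := le_trans (ler_norm _) Pr.
have even_ge0 j : 0 <= x j ^+ m.*2.+2.
  by rewrite -doubleS exprn_even_ge0 ?odd_double.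
have Sr : rho ^+ m.*2.+2 <= \sum_j x j ^+ m.*2.+2.
  rewrite (bigD1 k)//= -normrX ger0_norm//.
  by rewrite lerDl sumr_ge0.
move: Hx; rewrite ltNge => /negP; apply.
rewrite subr_le0; apply: le_trans Pr _.
apply: le_trans (ler_wpM2l (ltW eps0) Sr).
rewrite -addn2 exprD mulrCA [A * _]mulrC ler_wpM2l//.
  by rewrite exprn_ge0//; lra.
rewrite -ler_pdivrMl// mulrC expr2.
have : rho * 1 <= rho * rho by rewrite ler_wpM2l//; lra.
lra.
Qed.

(** The point [z] maximizes the penalized product [H] over the closed sign cell of [c], cut down to
    a compact box. Since [H c] is positive, so is [H z]; hence no [F j] vanishes at [z] and [z] is
    off the walls of the box. It is an interior maximum, where all partial derivatives of [H]
    vanish. *)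
Lemma penalized_critical_point (J : finType) (F : J -> (I -> R) -> R) D m
    (P : (I -> R) -> R) (dP : I -> (I -> R) -> R) (eps : R) (c : I -> R) :
  (forall j, polyfun D (F j)) -> (forall x, P x = \prod_j F j x ^+ 2) ->
  polyfun m.*2 P ->
  (forall i (x : I -> R),
    is_derive (x i) 1 (fun t => P (upd x i t)) (dP i x)) ->
  0 < eps -> eps * \sum_i c i ^+ m.*2.+2 < P c ->
  exists z, (forall j, (0 < F j z) = (0 < F j c)) /\
    forall i, dP i z = eps * m.*2.+2%:R * z i ^+ m.*2.+1.
Proof.
move=> pF PE pP derP eps0 Hc.
have [B boundB] := penalized_bound pP eps0.
pose H (x : I -> R) := P x - eps * \sum_i x i ^+ m.*2.+2.
pose s j : R := if 0 < F j c then 1 else -1.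
have Hc0 : 0 < H c by rewrite subr_gt0.
pose box := [set v : 'rV[R]_#|I| | forall k, `[(- B), B]%classic (v ord0 k)].
pose cell := \bigcap_(j in [set: J])
  [set v : 'rV[R]_#|I| | 0 <= s j * F j (of_row v)].
have Hpos x : 0 < H x -> forall j, F j x != 0.
  move=> Hx j; have : 0 < P x.
    apply: lt_le_trans Hx _.
    rewrite gerBl mulr_ge0 ?(ltW eps0)// sumr_ge0// => i _.
    by rewrite -doubleS exprn_even_ge0 ?odd_double.
  rewrite PE (bigD1 j)//=; apply: contraTneq => ->.
  by rewrite expr0n mul0r ltxx.
have sF x j : 0 < H x -> (0 < s j * F j x) = ((0 < F j x) == (0 < F j c)).
  move=> /Hpos/(_ j); rewrite /s neq_lt => /orP[] h.
    rewrite (lt_gtF h).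
    by case: (0 < F j c); rewrite ?mul1r ?mulN1r ?oppr_gt0 ?(lt_gtF h) ?h.
  rewrite h.
  by case: (0 < F j c); rewrite ?mul1r ?mulN1r ?oppr_gt0 ?(lt_gtF h) ?h.
have closed_cell : closed cell.
  apply: closed_bigI => j _.
  apply: (@preimage_closed _ _ (fun v => s j * F j (of_row v))
    [set x | 0 <= x]).
    move=> v _.
    exact: (polyfun_continuous (polyfunZ (s j) (pF j)) (x:=v)).
  exact: closed_ge.
have compactK : compact (box `&` cell).
  apply: compact_closedI => //.
  apply: (@rV_compact R _ (fun=> `[(- B), B]%classic)) => k.
  exact: segment_compact.
have cK x : (forall i, `|x i| < B) -> (forall j, 0 < s j * F j x) ->
    (box `&` cell) (to_row x).
  move=> xB xs; split=> [k|j _] /=; last by rewrite to_rowK ltW.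
  by rewrite mxE in_itv/= -ler_norml ltW.
have cKc : (box `&` cell) (to_row c).
  by apply: cK; [exact: (boundB _ Hc0)|move=> j; rewrite sF ?eqxx].
have pS : polyfun m.*2.+2 (fun x : I -> R => \sum_i x i ^+ m.*2.+2).
  apply: polyfun_sum => i; rewrite -[X in polyfun X]muln1.
  exact/polyfunX/polyfun_coord.
have pH : polyfun m.*2.+2 H.
  have := polyfunD (polyfunW (_ : (m.*2 <= m.*2.+2)%N) pP)
    (polyfunZ (- eps) pS).
  by rewrite leqW// => /(_ isT); apply: eq_polyfun => x; rewrite mulNr.
have contH : {within box `&` cell, continuous (H \o @of_row R I)}.
  exact/continuous_subspaceT/(polyfun_continuous pH).
have [v] := EVT_max_rV (ex_intro _ _ cKc) compactK contH.
rewrite inE => -[_ vcell] vmax; pose z := of_row v.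
have maxz x : (forall i, `|x i| < B) -> (forall j, 0 < s j * F j x) ->
    H x <= H z.
  move=> xB xs; have := vmax (to_row x); rewrite /= to_rowK; apply.
  by rewrite inE; exact: cK.
have Hz0 : 0 < H z.
  apply: (lt_le_trans Hc0); apply: maxz; first exact: (boundB _ Hc0).
  by move=> j; rewrite sF ?eqxx.
have sz j : 0 < s j * F j z.
  rewrite lt_neqAle eq_sym mulf_neq0 ?Hpos//=; first exact: (vcell j Logic.I).
  by rewrite /s; case: ifP => _; rewrite ?oner_eq0// oppr_eq0 oner_eq0.
exists z; split=> [j|i]; first by apply/eqP; rewrite -sF.
have derS (x : I -> R) :
  is_derive (x i) 1 (fun t => \sum_j upd x i t j ^+ m.*2.+2)
    (m.*2.+2%:R * x i ^+ m.*2.+1).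
  have -> : (fun t => \sum_j upd x i t j ^+ m.*2.+2) =
      (id : R -> R) ^+ m.*2.+2 + cst (\sum_(j | j != i) x j ^+ m.*2.+2).
    apply/funext => t; rewrite (bigD1 i)//= fctE /upd eqxx; congr (_ + _).
    by apply: eq_bigr => j /negPf ->.
  apply: is_derive_eq; rewrite addr0 /GRing.scale/= mulr1//.
have derH (x : I -> R) : is_derive (x i) 1 (fun t => H (upd x i t))
    (dP i x - eps * (m.*2.+2%:R * x i ^+ m.*2.+1)).
  exact: is_deriveB.
(* All constraints on the cell and the box are strict at [z], so they survive a small move of one
   coordinate. *)
have near_in :
    \forall t \near z i, `|t| < B /\ forall j, 0 < s j * F j (upd z i t).
  apply: filterS2 (_ : \forall t \near z i, `|t| < B)
      (_ : \forall t \near z i, forall j, 0 < s j * F j (upd z i t)).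
  - by move=> t.
  - have zc : `|t| @[t --> z i] --> `|z i| := @norm_continuous _ _ (z i).
    exact: (@cvgr_lt R R (nbhs (z i)) _ (fun t => `|t|) _ zc _
      (boundB _ Hz0 i)).
  - apply: (@filter_forall _ _ (fun j t => 0 < s j * F j (upd z i t))
      (nbhs (z i))) => j.
    have [f' _ df] := polyfun_derive i (polyfunZ (s j) (pF j)).
    have Fc : s j * F j (upd z i t) @[t --> z i] --> s j * F j (upd z i (z i)).
      by have [/derivable1_diffP/differentiable_continuous] := df z.
    apply: (@cvgr_gt R R (nbhs (z i)) _
      (fun t => s j * F j (upd z i t)) _ Fc).
    by rewrite upd_same.
have /nbhs_ballP[eta /= eta0 ball_in] := near_in.
have der0 : is_derive (z i) 1 (fun t => H (upd z i t)) 0.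
  apply: (@derive1_at_max _ _ (z i - eta) (z i + eta)).
  - lra.
  - move=> t _; have := derH (upd z i t).
    rewrite {1}/upd eqxx (_ : (fun _ => _) = fun t => H (upd z i t));
      last first.
      by apply/funext => t'; rewrite upd_upd.
    by case.
  - by rewrite in_itv/=; lra.
  - move=> t; rewrite in_itv/= => ht; rewrite upd_same.
    have [|tB ts] := ball_in t.
      by rewrite /ball/= ltr_norml; lra.
    apply: maxz => // k; rewrite /upd; case: eqP => // _; exact: (boundB _ Hz0).
have [_ d0] := der0; have [_] := derH z; rewrite d0 => /esym/eqP.
by rewrite subr_eq0 mulrA => /eqP.
Qed.

(* Each realized strict sign pattern is an open cell; maximizing the penalized
   product of squares on it yields a solution of a system with at most
   [(2 #|J| D + 1) ^ #|I|] solutions, and distinct cells give distinct ones. *)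
Lemma sign_patterns_bound (T J : finType) (F : J -> (I -> R) -> R) D
    (c : T -> I -> R) :
  (forall j, polyfun D (F j)) -> (forall t j, F j (c t) != 0) ->
  (forall t t', (forall j, (0 < F j (c t)) = (0 < F j (c t'))) -> t = t') ->
  (#|T| <= ((#|J| * D).*2.+1) ^ #|I|)%N.
Proof.
move=> pF F0 Finj; set m := (#|J| * D)%N.
pose P x := \prod_j F j x ^+ 2.
have pP : polyfun m.*2 P.
  rewrite /m -mul2n mulnCA; apply: polyfun_prod => j; exact: polyfunX.
have dP_ex i : exists dP : (I -> R) -> R, polyfun m.*2 dP /\
    forall x : I -> R, is_derive (x i) 1 (fun t => P (upd x i t)) (dP x).
  by have [g pg dg] := polyfun_derive i pP; exists g.
have [dP hdP] := choice dP_ex.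
pose S t := 1 + \sum_i c t i ^+ m.*2.+2.
have S0 t : 0 < S t.
  rewrite ltr_wpDr// sumr_ge0// => i _.
  by rewrite -doubleS exprn_even_ge0 ?odd_double.
have P0 t : 0 < P (c t).
  by apply: prodr_gt0 => j _; rewrite exprn_even_gt0//= F0.
(* One [eps] serves all patterns, so that all critical points solve the same system. *)
have [eps eps0 Heps] := finite_pos_lb (fun t => divr_gt0 (P0 t) (S0 t)).
have crit t : exists z, (forall j, (0 < F j z) = (0 < F j (c t))) /\
    forall i, dP i z = eps * m.*2.+2%:R * z i ^+ m.*2.+1.
  apply: (penalized_critical_point (P := P) pF) => //.
    by move=> i; have [] := hdP i.
  have := Heps t; rewrite ltr_pdivlMr// => /(le_lt_trans _); apply.
  by rewrite ler_wpM2l ?(ltW eps0)// lerDr.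
have [z hz] := choice crit.
have k0 : eps * m.*2.+2%:R != 0 by rewrite mulf_neq0 ?gt_eqF.
(* Dividing the critical equations by [eps * m.*2.+2%:R] leaves [z i ^+ m.*2.+1] equal to a
   polynomial function of degree at most [m.*2]. *)
apply: (@leq_card_zeros _ _ _ (fun i x => (eps * m.*2.+2%:R)^-1 * dP i x) _ z).
- by move=> i; apply: polyfunZ; have [] := hdP i.
- by move=> t i; have [_ ->] := hz t; rewrite mulKf.
- move=> t t' zz; apply: Finj => j.
  by have [<- _] := hz t; have [<- _] := hz t'; rewrite zz.
Qed.

End SignPatterns.

(** * Sign patterns of spline networks *)

Section SplinePieces.
Variable R : realType.
Implicit Types (t : seq R) (b : nat -> bool).

(* The polynomial to which [bspline t k i] restricts on the set of points [x]
   with [b l = (t`_l <= x)] for all [l]. *)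
Fixpoint bspline_piece t b (k i : nat) : {poly R} :=
  if k is k'.+1 then
    (t`_(i + k) - t`_i)^-1 *: (('X - (t`_i)%:P) * bspline_piece t b k' i)
    + (t`_(i + k).+1 - t`_i.+1)^-1 *:
        (((t`_(i + k).+1)%:P - 'X) * bspline_piece t b k' i.+1)
  else if b i && ~~ b i.+1 then 1 else 0.

Lemma bspline_pieceE t k i x :
  bspline t k i x = (bspline_piece t (fun l => t`_l <= x) k i).[x].
Proof.
elim: k i => [|k IH] i /=.
  by rewrite ltNge; case: ifP; rewrite hornerE.
by rewrite !IH !(hornerD, hornerZ, hornerM, hornerN, hornerX, hornerC); ring.
Qed.

(** A piece depends only on comparisons with finitely many knots; for the splines of a network these
    all lie inside the knot tuple. *)
Lemma eq_bspline_piece t b b' k i :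
  (forall l, (l <= (i + k).+1)%N -> b l = b' l) ->
  bspline_piece t b k i = bspline_piece t b' k i.
Proof.
elim: k i => [|k IH] i bb /=; first by rewrite !bb; [|lia|lia].
by rewrite !IH// => l li; apply: bb; lia.
Qed.

Lemma size_bspline_piece t b k i : (size (bspline_piece t b k i) <= k.+1)%N.
Proof.
elim: k i => [|k IH] i /=.
  by case: ifP; rewrite ?size_poly1 ?size_poly0.
have step (a : R) (p : {poly R}) j : size p = 2%N ->
    (size (a *: (p * bspline_piece t b k j)) <= k.+2)%N.
  move=> p2; apply: leq_trans (size_scale_leq _ _) _.
  by apply: leq_trans (size_polyMleq _ _) _; rewrite p2 /= ltnS IH.
rewrite (leq_trans (size_polyD _ _))// geq_max !step//.
  by rewrite -opprB size_polyN size_XsubC.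
by rewrite size_XsubC.
Qed.

End SplinePieces.

Section KanPatterns.
Variables (R : realType) (d N k G : nat).
Variables (t0 : 'I_N -> 'I_d -> (G + k.*2).-tuple R).
Variables (t1 : 'I_N -> (G + k.*2).-tuple R).
Hypotheses (k0 : (0 < k)%N) (G0 : (0 < G)%N).
Local Notation P := (G + k - 1)%N.
Local Notation param := ('I_N * 'I_d * 'I_P + 'I_N * 'I_P)%type.

Lemma card_param : #|{: param}| = (N * P * d.+1)%N.
Proof. by rewrite card_sum !card_prod !card_ord; lia. Qed.

(** The two factors come from two uses of [sign_patterns_bound] in the coefficients: one counts the
    positions of the inner sums relative to the outer knots, the other counts the output signs among
    networks that share these positions. *)
Lemma kan_shatter_bound (T : finType) (X : T -> 'rV[R]_d) :
  (forall s : {ffun T -> bool}, exists2 phi, kan t0 t1 phi &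
     forall t, phi (X t) != 0 /\ (0 < phi (X t)) = s t) ->
  (2 ^ #|T| <= ((N * #|T| * (G + k.*2)).*2.+1 * (#|T| * k.+1).*2.+1)
                 ^ (N * P * d.+1))%N.
Proof.
move=> shatter.
(* At the fixed points [X t] the inner splines are constants, so the inner sums are linear in the
   coefficients. *)
pose y j t (c : param -> R) := \sum_(i < d) \sum_(p < P)
  bspline (t0 j i) k p (X t 0 i) * c (inl (j, i, p)).
have py j t : polyfun 1 (y j t).
  by do 2!apply: polyfun_sum => ?; apply/polyfunZ/polyfun_coord.
pose value (c : param -> R) t := \sum_(j < N) \sum_(p < P)
  c (inr (j, p)) * bspline (t1 j) k p (y j t c).
have realize (s : {ffun T -> bool}) : exists c : param -> R,
    forall t, value c t != 0 /\ (0 < value c t) = s t.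
  have [phi [f0 [f1 [f0E f1E ->]]] hs] := shatter s.
  have [c0 hc0] := choice (fun ji : 'I_N * 'I_d => f0E ji.1 ji.2).
  have [c1 hc1] := choice f1E.
  pose cs (i : param) :=
    match i with inl (j, i, p) => c0 (j, i) p | inr (j, p) => c1 j p end.
  exists cs => t /=; have := hs t.
  suff -> : two_layer f0 f1 (X t) = value cs t by [].
  apply: eq_bigr => j _; rewrite hc1; apply: eq_bigr => p _.
  congr (_ * bspline _ _ _ _); apply: eq_bigr => i _.
  by rewrite (hc0 (j, i)); apply: eq_bigr => q _ /=; exact: mulrC.
have [c hc] := choice realize.
pose Q := ('I_N * T * 'I_(G + k.*2))%type.
pose knot (q : Q) : R := (t1 q.1.1)`_q.2.
pose yq (q : Q) := y q.1.1 q.1.2.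
pose pat s : {ffun Q -> bool} := [ffun q => knot q <= yq q (c s)].
(* Lowering all knots by a small [delta] makes the finitely many comparisons
   with knots strict. *)
have [delta delta0 hdelta] : exists2 delta : R, 0 < delta &
    forall s q, (yq q (c s) - knot q + delta != 0) /\
      (0 < yq q (c s) - knot q + delta) = pat s q.
  (* Where the comparison holds, any positive [delta] will do; where it fails, [delta] must stay
     below the gap to the knot. *)
  pose u (sq : {ffun T -> bool} * Q) : R :=
    if pat sq.1 sq.2 then 1 else knot sq.2 - yq sq.2 (c sq.1).
  have [sq|delta delta0 hd] := @finite_pos_lb R _ u.
    by rewrite /u ffunE; case: (leP (knot _)) => h; rewrite ?subr_gt0.
  exists delta => // s q; have := hd (s, q); rewrite /u /= ffunE.
  case: (leP (knot _)) => h hd'.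
    have h' : 0 < yq q (c s) - knot q + delta by lra.
    by rewrite h' gt_eqF.
  have h' : yq q (c s) - knot q + delta < 0 by lra.
  by rewrite lt_eqF// lt_gtF.
have few_pats : (#|[set pat s | s : {ffun T -> bool}]| <=
    (N * #|T| * (G + k.*2)).*2.+1 ^ (N * P * d.+1))%N.
  have rep (b : {b | b \in [set pat s | s : {ffun T -> bool}]}) :
      exists s, pat s = val b.
    by case: b => b /= /imsetP[s _ ->]; exists s.
  have [r hr] := choice rep.
  rewrite -card_sig -card_param.
  have -> : (N * #|T| * (G + k.*2) = #|{: Q}| * 1)%N.
    by rewrite !card_prod !card_ord muln1.
  apply: (@sign_patterns_bound R _ _ _ (fun q x => yq q x - knot q + delta) 1
    (c \o r)).
  - move=> q; apply: polyfunD; last exact: polyfun_cst.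
    by apply: polyfunD; [exact: py|exact: polyfun_cst].
  - by move=> b q; have [] := hdelta (r b) q.
  - move=> b b' bb; apply: val_inj; rewrite -!hr; apply/ffunP => q.
    by have [_ <-] := hdelta (r b) q; have [_ <-] := hdelta (r b') q; exact: bb.
have small_fibers b : (#|[set s | pat s == b]| <=
    (#|T| * k.+1).*2.+1 ^ (N * P * d.+1))%N.
  (* The default [false] is never read: the pieces with [p < P] only involve knot indices up to
     [p + k + 1], below [G + k.*2]. *)
  pose side j t l := if insub l is Some l' then b (j, t, l') else false.
  pose piece t j (p : nat) := bspline_piece (t1 j) (side j t) k p.
  pose value' t (x : param -> R) := \sum_(j < N) \sum_(p < P)
    x (inr (j, p)) * (piece t j p).[y j t x].
  have value'E s t :
      s \in [set s | pat s == b] -> value' t (c s) = value (c s) t.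
    rewrite inE => /eqP sb; apply: eq_bigr => j _; apply: eq_bigr => p _.
    rewrite bspline_pieceE; congr (_ * (_ : {poly R}).[_]).
    apply: eq_bspline_piece => l lp.
    have lG : (l < G + k.*2)%N by have := ltn_ord p; lia.
    by rewrite /side (insubT (fun l => l < G + k.*2)%N lG) -sb ffunE.
  rewrite -card_sig -card_param.
  apply: (@sign_patterns_bound R _ _ _ value' k.+1 (c \o val)).
  - move=> t; apply: polyfun_sum => j; apply: polyfun_sum => p.
    have pp : polyfun k (fun x => (piece t j p).[y j t x]).
      apply: polyfunW (polyfun_horner _ (py _ _)); rewrite muln1.
      by have := size_bspline_piece (t1 j) (side j t) k p; rewrite /piece; lia.
    (* Degree [k.+1]: one for the outer coefficient and [k] for the piece evaluated at a linear
       form. *)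
    exact: (polyfunM (polyfun_coord R (inr (j, p) : param)) pp).
  - by move=> [s sb] t /=; rewrite value'E//; have [] := hc s t.
  - move=> [s sb] [s' sb'] /= ss; apply: val_inj; apply/ffunP => t /=.
    have := ss t; rewrite !value'E//.
    by have [_ ->] := hc s t; have [_ ->] := hc s' t.
(* The [2 ^ #|T|] sign patterns are summed along the fibers of [pat]. *)
have -> : (2 ^ #|T| = \sum_(s in [set: {ffun T -> bool}]%SET) 1)%N.
  by rewrite sum1_card cardsT card_ffun card_bool.
rewrite (partition_big_imset pat) /= expnMn.
have -> : pat @: [set: {ffun T -> bool}]%SET =
    [set pat s | s : {ffun T -> bool}].
  by apply/setP => b; apply/imsetP/imsetP => -[s _ ->]; exists s.
apply: (@leq_trans (\sum_(b in [set pat s | s : {ffun T -> bool}]%SET)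
    (#|T| * k.+1).*2.+1 ^ (N * P * d.+1))).
  apply: leq_sum => b _; apply: leq_trans (small_fibers b).
  rewrite sum1dep_card.
  by apply: subset_leq_card; apply/fintype.subsetP => s; rewrite !inE.
by rewrite sum_nat_const leq_mul2r few_pats orbT.
Qed.

End KanPatterns.

(** * Countable covers of a box *)

Section BoxCovers.
Variables (R : realType) (I : eqType) (S : finType).
Implicit Types (lo hi : nat -> S -> I -> R) (w : nat -> S -> R).
Implicit Types (u v x : I -> R).

Local Notation mu := (@lebesgue_measure R).

Lemma measurable_scaled_indic (c l h : R) (D : set R) :
  measurable_fun D (EFin \o (fun t : R => c * \1_(`[l, h]%classic) t)).
Proof.
apply/measurable_EFinP; exact: measurable_funM.
Qed.

Lemma lebesgue_measure_segment (l h : R) : l <= h ->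
  mu `[l, h]%classic = (h - l)%:E.
Proof.
move=> lh; rewrite lebesgue_measure_itv/= lte_fin; case: ltP => // hl.
have -> : h = l by apply/eqP; rewrite eq_le lh hl.
by rewrite subrr.
Qed.

Lemma integral_scaled_indic_le (c l h u v : R) : 0 <= c -> l <= h ->
  (\int[mu]_(t in `[u, v]) (c * \1_(`[l, h]%classic) t)%:E
    <= (c * (h - l))%:E)%E.
Proof.
move=> c0 lh; under eq_integral do rewrite EFinM.
rewrite ge0_integralZl_EFin//; last first.
  by apply/measurable_EFinP; exact: measurable_indic.
rewrite integral_indic// EFinM lee_wpmul2l ?lee_fin//.
rewrite -lebesgue_measure_segment//.
by apply: le_measure; rewrite ?inE//; exact: measurableI.
Qed.

(* Integrating the covering inequality over one coordinate at a time. *)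
Lemma cover_volume (r : seq I) (K : R) lo hi w u v :
  uniq r -> 0 <= K -> (forall n s, 0 <= w n s) ->
  (forall n s i, lo n s i <= hi n s i) -> (forall i, u i <= v i) ->
  (forall x, (forall i, u i <= x i <= v i) ->
    (K%:E <= \sum_(0 <= n <oo)
       (\sum_s w n s *
          \prod_(i <- r) \1_(`[lo n s i, hi n s i]%classic) (x i))%:E)%E) ->
  ((K * \prod_(i <- r) (v i - u i))%:E <= \sum_(0 <= n <oo)
       (\sum_s w n s * \prod_(i <- r) (hi n s i - lo n s i))%:E)%E.
Proof.
elim: r K w => [|i r IH] K w /=.
  move=> _ _ w0 _ uv /(_ u); rewrite big_nil mulr1 => H.
  apply: le_trans (H _) _ => [i|]; first by rewrite lexx uv.
  apply: lee_nneseries => [n _ _|n _].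
    by rewrite lee_fin sumr_ge0// => s _; rewrite big_nil mulr1.
  by rewrite lee_fin; apply: ler_sum => s _; rewrite !big_nil.
move=> /andP[ir ur] K0 w0 lohi uv H.
rewrite big_cons mulrA.
rewrite (eq_eseriesr (g := fun n => (\sum_s w n s * (hi n s i - lo n s i) *
  \prod_(j <- r) (hi n s j - lo n s j))%:E)); last first.
  by move=> n _; congr EFin; apply: eq_bigr => s _; rewrite big_cons mulrA.
(* The weights absorb the side lengths in coordinate [i] and [K] absorbs [v i - u i]. What remains
   is the covering inequality integrated over that coordinate, the others being fixed. *)
apply: IH => //.
- by rewrite mulr_ge0// subr_ge0.
- by move=> n s; rewrite mulr_ge0// subr_ge0.
move=> x xuv.
pose x' t j := if j == i then t else x j.
pose p n s : R := \prod_(j <- r) \1_(`[lo n s j, hi n s j]%classic) (x j).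
have p0 n s : 0 <= p n s by apply: prodr_ge0.
pose g n s (t : R) := (w n s * p n s) * \1_(`[lo n s i, hi n s i]%classic) t.
have g0 n s t : 0 <= g n s t by rewrite !mulr_ge0.
have mg n : measurable_fun `[u i, v i] (EFin \o (fun t => \sum_s g n s t)).
  apply/measurable_EFinP; apply: measurable_sum => s.
  by apply/measurable_EFinP; exact: measurable_scaled_indic.
have Hg t : `[u i, v i]%classic t ->
    (K%:E <= \sum_(0 <= n <oo) (\sum_s g n s t)%:E)%E.
  rewrite /= in_itv/= => ht.
  apply: le_trans (H (x' t) _) _ => [j|].
    by rewrite /x'; case: eqP => [->|_].
  apply: lee_nneseries => n _.
    by rewrite lee_fin sumr_ge0// => s _; rewrite mulr_ge0// prodr_ge0.
  rewrite lee_fin; apply: ler_sum => s _; rewrite big_cons /g /x' eqxx.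
  have -> : \prod_(j <- r) \1_(`[lo n s j, hi n s j]%classic)
      (if j == i then t else x j) = p n s.
    apply: eq_big_seq => j jr; case: eqP => // ji; by rewrite -ji jr in ir.
  by rewrite mulrA mulrAC.
have <- : (\int[mu]_(t in `[u i, v i]) cst K%:E t = (K * (v i - u i))%:E)%E.
  by rewrite integral_cst//= lebesgue_measure_segment// EFinM.
apply: (@le_trans _ _ (\int[mu]_(t in `[u i, v i])
    \sum_(0 <= n <oo) (\sum_s g n s t)%:E)%E).
  apply: ge0_le_integral => //.
  apply: ge0_emeasurable_sum => [n t _ _|n _]; last exact: mg.
  by rewrite lee_fin sumr_ge0.
rewrite integral_nneseries//; last first.
  by move=> n t _; rewrite lee_fin sumr_ge0.
apply: lee_nneseries => [n _ _|n _].
  by apply: integral_ge0 => t _; rewrite lee_fin sumr_ge0.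
under eq_integral do rewrite -sumEFin.
rewrite ge0_integral_sum//; last 2 first.
- by move=> s; exact: measurable_scaled_indic.
- by move=> s t _; rewrite lee_fin.
rewrite -sumEFin; apply: lee_sum => s _.
apply: le_trans (integral_scaled_indic_le _ _ _ _) _ => //.
  by rewrite mulr_ge0.
by rewrite lee_fin mulrAC.
Qed.

End BoxCovers.

(** Otherwise covers of the [A s] of small total volume would together cover a box of positive
    volume, against [cover_volume]. *)
Lemma null_sets_miss_box (R : realType) (d : nat) (S : finType)
    (A : S -> set 'rV[R]_d) (u v : 'I_d -> R) :
  (forall s, lebesgue_outer (A s) = 0%E) -> (forall i, u i < v i) ->
  exists x : 'rV[R]_d, (forall i, u i <= x 0 i <= v i) /\ forall s, ~ A s x.
Proof.
move=> A0 uv; apply: contrapT => /forallNP noX.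
have AX (x : 'rV[R]_d) : (forall i, u i <= x 0 i <= v i) -> exists s, A s x.
  by move=> xuv; apply: contrapT => /forallNP nA; apply: (noX x).
pose V := \prod_i (v i - u i).
have V0 : 0 < V by apply: prodr_gt0 => i _; rewrite subr_gt0.
(* The successor keeps the sum of [#|S|] copies of [eps] strictly below [V], also for empty [S]. *)
pose eps := V / #|S|.+1%:R.
have eps0 : 0 < eps by rewrite divr_gt0.
have cover s : exists ab : (nat -> 'rV[R]_d) * (nat -> 'rV[R]_d),
    [/\ forall n i, ab.1 n 0 i <= ab.2 n 0 i,
        forall x, A s x ->
          exists n, forall i, ab.1 n 0 i <= x 0 i <= ab.2 n 0 i &
        (\sum_(0 <= n <oo) (\prod_(i < d) (ab.2 n 0 i - ab.1 n 0 i))%:E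
          < eps%:E)%E].
  have : (lebesgue_outer (A s) < eps%:E)%E by rewrite A0 lte_fin.
  by move=> /ereal_inf_lt[_ [a [b [ab cov ->]]] lt_eps]; exists (a, b).
have [ab hab] := choice cover.
have ab_le n s i : (ab s).1 n 0 i <= (ab s).2 n 0 i.
  by have [+ _ _] := hab s; apply.
have := @cover_volume R 'I_d S (index_enum 'I_d) 1 (fun n s i => (ab s).1 n 0 i)
  (fun n s i => (ab s).2 n 0 i) (fun _ _ => 1) u v (index_enum_uniq _) ler01
  (fun _ _ => ler01) ab_le (fun i => ltW (uv i)).
have -> : (1 * \prod_(i <- index_enum 'I_d) (v i - u i)) = V by rewrite mul1r.
move=> H; suff : (V%:E < V%:E)%E by rewrite ltxx.
apply: (@le_lt_trans _ _ (\sum_(s : S) eps%:E)%E); last first.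
  rewrite sumEFin lte_fin sumr_const -mulr_natr /eps -mulrA gtr_pMr//.
  by rewrite mulrC ltr_pdivrMr// mul1r ltr_nat.
apply: le_trans (H _) _ => [x xuv|].
  have [|s] := AX (\row_i x i); first by move=> i; rewrite mxE.
  have [_ cov _] := hab s; move=> /cov[n hn].
  have t0 m s' : 0 <= 1 *
      \prod_i \1_(`[(ab s').1 m 0 i, (ab s').2 m 0 i]%classic) (x i) :> R.
    by rewrite mul1r prodr_ge0.
  (* The box of index [n] in the cover of [A s] contains the point, so the partial sum of length
     [n.+1] is already at least 1. *)
  apply: le_trans (nneseries_lim_ge n.+1 _); last first.
    by move=> m _ _; rewrite lee_fin sumr_ge0.
  rewrite big_nat_recr//= -[X in (X <= _)%E]add0e; apply: leeD.
    by apply: sume_ge0 => m _; rewrite lee_fin sumr_ge0.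
  rewrite lee_fin (bigD1 s)//= -[X in X <= _]addr0 lerD//; last exact: sumr_ge0.
  rewrite mul1r big1// => i _; rewrite indicE mem_set//= in_itv/=.
  by have := hn i; rewrite mxE.
under eq_eseriesr do rewrite -sumEFin.
rewrite nneseries_sum; last first.
  by move=> s n _; rewrite lee_fin mul1r prodr_ge0// => i _; rewrite subr_ge0.
apply: lee_sum => s _; under eq_eseriesr do rewrite mul1r.
by have [_ _ /ltW] := hab s.
Qed.

(** * Bump functions on a grid *)

(** For [b <= a], dividing by [a] and setting [t = b / a] reduces this to the fact that the powers
    of [t] and [1 - t] sum to at least 1; each is at least its base, as both bases lie in the unit
    interval. *)
Lemma powR_holder (R : realType) (a b alpha : R) : 0 <= a -> 0 <= b ->
  0 < alpha <= 1 -> `|a `^ alpha - b `^ alpha| <= `|a - b| `^ alpha.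
Proof.
move=> a0 b0 /andP[al0 al1]; wlog ba : a b a0 b0 / b <= a.
  move=> H; case/orP: (le_total b a) => ab; first exact: H.
  by rewrite distrC [`|a - b|]distrC H.
rewrite !ger0_norm ?subr_ge0 ?ge0_ler_powR ?nnegrE ?(ltW al0)//.
rewrite lerBlDl; have [a00|a1] := eqVneq a 0.
  have b00 : b = 0 by apply/eqP; rewrite eq_le b0 -a00 ba.
  by rewrite a00 b00 lerDl powR_ge0.
have {a1} a1 : 0 < a by rewrite lt_neqAle eq_sym a1.
have pow_ge (t : R) : 0 <= t <= 1 -> t <= t `^ alpha.
  move=> /andP[t0 t1]; have [->|t2] := eqVneq t 0; first exact: powR_ge0.
  by apply: ger1_powR => //; rewrite lt_neqAle eq_sym t2 t0.
have -> : b = a * (b / a) by rewrite mulrCA mulfV ?gt_eqF// mulr1.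
set t := b / a.
have /andP[t0 t1] : 0 <= t <= 1 by rewrite divr_ge0//= ler_pdivrMr// mul1r.
have s0 : 0 <= 1 - t by rewrite subr_ge0.
have -> : a - a * t = a * (1 - t) by ring.
rewrite (@powRM _ a t)// (@powRM _ a (1 - t))//.
rewrite -mulrDr -[X in X <= _]mulr1 ler_wpM2l ?powR_ge0//.
have /pow_ge tp : 0 <= t <= 1 by rewrite t0.
have /pow_ge sp : 0 <= 1 - t <= 1 by rewrite s0 gerBl.
lra.
Qed.

Lemma row_norm_le (R : realType) (d : nat) (x : 'rV[R]_d) (c : R) :
  0 <= c -> (forall i, `|x 0 i| <= c) -> `|x| <= c.
Proof.
move=> c0 xc; have -> : `|x| = mx_norm x by [].
rewrite mx_normrE; apply: bigmax_le => // -[i j] _ /=.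
by rewrite ord1.
Qed.

Lemma coord_le_norm (R : realType) (d : nat) (x : 'rV[R]_d) i :
  `|x 0 i| <= `|x|.
Proof.
have -> : `|x| = mx_norm x by [].
rewrite mx_normrE.
exact: (bigmax_sup (ord0, i)).
Qed.

(** Bumps are built from the max norm, whose balls fit the grid, while the Hölder class uses the
    Euclidean norm. *)
Lemma norm_le_enorm (R : realType) (d : nat) (x : 'rV[R]_d) : `|x| <= enorm x.
Proof.
apply: row_norm_le => [|j]; first exact: sqrtr_ge0.
rewrite -sqrtr_sqr ler_sqrt ?sumr_ge0// => [|k _]; last exact: sqr_ge0.
by rewrite (bigD1 j)//= lerDl sumr_ge0// => k _; exact: sqr_ge0.
Qed.

(** Half the side of a grid cell. *)
Definition bump_radius (R : realType) (m : nat) : R := (2 * m%:R)^-1.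

Section Bumps.
Variables (R : realType) (d m : nat) (alpha : R).
Hypotheses (m0 : (0 < m)%N) (alpha01 : 0 < alpha <= 1).

Local Notation cell := {ffun 'I_d -> 'I_m}.
Local Notation rad := (bump_radius R m).

Definition cell_center (l : cell) : 'rV[R]_d :=
  \row_i (((l i)%:R + 2^-1) / m%:R).

(** A maximum of cones, rather than a sum, has Lipschitz constant 1 without any discussion of
    supports. *)
Definition tents (s : {ffun cell -> bool}) (b : bool) (x : 'rV[R]_d) : R :=
  \big[Num.max/0]_(l | s l == b) (rad - `|x - cell_center l|).

(** The positive and the negative tents each have Hölder constant 1 after taking powers; the factor
    [2^-1] brings their difference back to 1. *)
Definition bumps (s : {ffun cell -> bool}) (x : 'rV[R]_d) : R :=
  2^-1 * (tents s true x `^ alpha - tents s false x `^ alpha).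

Lemma rad_gt0 : 0 < rad.
Proof. by rewrite /bump_radius invr_gt0 mulr_gt0// ltr0n. Qed.

Lemma tents_ge0 s b x : 0 <= tents s b x.
Proof. exact: bigmax_ge_id. Qed.

Lemma tents_lipschitz s b x y : `|tents s b x - tents s b y| <= `|x - y|.
Proof.
have half x' y' : tents s b x' <= tents s b y' + `|x' - y'|.
  apply: bigmax_le => [|l sl]; first by rewrite addr_ge0// tents_ge0.
  have : rad - `|y' - cell_center l| <= tents s b y'.
    exact: (bigmax_sup l).
  have := ler_distD x' y' (cell_center l); rewrite [`|y' - x'|]distrC; lra.
rewrite ler_norml; have := half x y; have := half y x; rewrite [`|y - x|]distrC.
lra.
Qed.

Lemma bumps_holder s : holder 1 alpha (cube R d) (bumps s).
Proof.
move=> x y _ _; rewrite mul1r /bumps -mulrBr normrM ger0_norm ?invr_ge0//.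
have tent b : `|tents s b x `^ alpha - tents s b y `^ alpha|
    <= enorm (x - y) `^ alpha.
  apply: le_trans (powR_holder _ _ alpha01) _; rewrite ?tents_ge0//.
  case/andP: alpha01 => al0 al1.
  apply: ge0_ler_powR; rewrite ?nnegrE ?(ltW al0)//.
    exact: sqrtr_ge0.
  exact: le_trans (tents_lipschitz _ _ _ _) (norm_le_enorm _).
have -> (p q p' q' : R) : p - q - (p' - q') = (p - p') - (q - q') by ring.
rewrite ler_pdivrMl// mulr_natl mulr2n.
exact: le_trans (ler_normB _ _) (lerD (tent true) (tent false)).
Qed.

(** A box of positive volume instead of the center alone: approximation holds only almost
    everywhere, so test points must be able to avoid null sets. *)
Definition near_center (l : cell) (x : 'rV[R]_d) :=
  forall i, cell_center l 0 i - rad / 2 <= x 0 i <= cell_center l 0 i + rad / 2.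

Lemma near_center_cube l x : near_center l x -> cube R d x.
Proof.
(* In units of [rad], the center has coordinate [2 * l i + 1] and the side of the cube is
   [2 * m]. *)
move=> xl i; have := xl i; rewrite mxE mulrDl -[2^-1 / m%:R]invfM -/rad.
have -> : (l i)%:R / m%:R = (l i)%:R * 2 * rad :> R.
  by rewrite /bump_radius invfM mulrA mulfK.
have : 1 = m%:R * 2 * rad :> R.
  rewrite /bump_radius mulrC [m%:R * 2]mulrC mulVf// mulf_neq0//.
  by rewrite pnatr_eq0 -lt0n.
have : ((l i).+1%:R : R) <= m%:R by rewrite ler_nat.
move=> /(ler_wpM2r (ltW rad_gt0)); rewrite -natr1.
have : 0 <= (l i)%:R * rad by rewrite mulr_ge0// ltW// rad_gt0.
have := rad_gt0; lra.
Qed.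

Lemma near_center_norm l x : near_center l x -> `|x - cell_center l| <= rad / 2.
Proof.
move=> xl; apply: row_norm_le => [|j]; first by have := rad_gt0; lra.
by have := xl j; rewrite !mxE ler_distl; lra.
Qed.

Lemma cell_center_dist l l' :
  l != l' -> 2 * rad <= `|cell_center l - cell_center l'|.
Proof.
move=> ll'; have [i li] : exists i, l i != l' i.
  apply: contrapT => /forallNP H; case/negP: ll'; apply/eqP/ffunP => i.
  by apply: contrapT => /eqP; apply: H.
apply: le_trans (coord_le_norm _ i).
rewrite !mxE -mulrBl normrM [`|m%:R^-1|]ger0_norm ?invr_ge0//.
have -> : 2 * rad = 1 * m%:R^-1.
  by rewrite /bump_radius invfM mulrA mulfV// mul1r.
rewrite ler_wpM2r ?invr_ge0//.
have -> : (l i)%:R + 2^-1 - ((l' i)%:R + 2^-1) = (l i)%:R - (l' i)%:R :> R.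
  by ring.
have : (l i != l' i :> nat) by [].
rewrite neq_ltn ler_normr => /orP[]; rewrite -(ler_nat R) -natr1 => h;
  apply/orP; [right|left]; lra.
Qed.

(** The cone of [l] still has height at least [rad / 2] at [x], whereas centers of the opposite sign
    are at distance at least [3 / 2 * rad] from [x], so their cones are cut off at 0. *)
Lemma bumps_near_center (s : {ffun cell -> bool}) l x : near_center l x ->
  if s l then 2^-1 * (rad / 2) `^ alpha <= bumps s x
  else bumps s x <= - (2^-1 * (rad / 2) `^ alpha).
Proof.
move=> /near_center_norm xl.
(* Zero to the power zero is 1, so a nonzero exponent is what makes the vanishing tents contribute
   0. *)
have al0 : alpha != 0 by case/andP: alpha01 => ? _; rewrite gt_eqF.
have big : (rad / 2) `^ alpha <= tents s (s l) x `^ alpha.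
  case/andP: alpha01 => al _; apply: ge0_ler_powR; rewrite ?nnegrE ?(ltW al)//.
  - by have := rad_gt0; lra.
  - exact: tents_ge0.
  - apply: le_trans (_ : rad - `|x - cell_center l| <= _); first lra.
    exact: (bigmax_sup l).
have small : tents s (~~ s l) x = 0.
  apply/eqP; rewrite eq_le tents_ge0 andbT; apply: bigmax_le => // l' sl'.
  have ll' : l != l' by apply: contraTneq sl' => <-; case: (s l).
  have := cell_center_dist ll'.
  have := ler_distD x (cell_center l) (cell_center l').
  rewrite [`|cell_center l - x|]distrC; have := rad_gt0; lra.
rewrite /bumps; case: (s l) big small => /= big ->; rewrite powR0//; lra.
Qed.

End Bumps.

(** * The lower bound *)

Section LowerBound.
Variables (R : realType) (d N k G : nat) (alpha : R).
Variables (t0 : 'I_N -> 'I_d -> (G + k.*2).-tuple R).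
Variables (t1 : 'I_N -> (G + k.*2).-tuple R).
Hypotheses (k0 : (0 < k)%N) (G0 : (0 < G)%N) (alpha01 : 0 < alpha <= 1).

Lemma Linfty_norm_lt (E : set 'rV[R]_d) g (h : R) :
  (Linfty_norm E g < h%:E)%E ->
  exists2 Z : set 'rV[R]_d, lebesgue_outer Z = 0%E &
    forall x, E x -> ~ Z x -> `|g x| < h.
Proof.
move=> /ereal_inf_lt[M M0 Mh]; exists [set x | E x /\ (M < `|g x|%:E)%E] => //.
move=> x Ex /= /not_andP[//|/negP]; rewrite -leNgt => gM.
by rewrite -lte_fin; exact: le_lt_trans Mh.
Qed.

(** An error below the bump height would give, for each [s], a network with the signs of
    [bumps alpha s] almost everywhere near the centers; the network class would then shatter [m ^ d]
    points, against [kan_shatter_bound]. *)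
Lemma best_approx_error_ge (m : nat) : (0 < m)%N ->
  (((N * m ^ d * (G + k.*2)).*2.+1 * (m ^ d * k.+1).*2.+1)
     ^ (N * (G + k - 1) * d.+1) < 2 ^ (m ^ d))%N ->
  ((2^-1 * (bump_radius R m / 2) `^ alpha)%:E
     <= best_approx_error alpha (kan t0 t1))%E.
Proof.
move=> m0; set h := 2^-1 * _; apply: contraTT; rewrite -ltNge -leqNgt => err.
have approx (s : {ffun {ffun 'I_d -> 'I_m} -> bool}) : exists phi,
    kan t0 t1 phi /\ (Linfty_norm (cube R d) (phi \- bumps alpha s)%R < h%:E)%E.
  have : (ereal_inf [set Linfty_norm (cube R d) (phi \- bumps alpha s)%R
      | phi in kan t0 t1] < h%:E)%E.
    apply: le_lt_trans err; apply: ereal_sup_ubound.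
    by exists (bumps alpha s) => //; exact: bumps_holder.
  by move=> /ereal_inf_lt[_ [phi Aphi <-] lt_h]; exists phi.
have [phi hphi] := choice approx.
have null s : exists Z : set 'rV[R]_d, lebesgue_outer Z = 0%E /\
    forall x, cube R d x -> ~ Z x -> `|(phi s \- bumps alpha s) x| < h.
  by have [_ /Linfty_norm_lt[Z Z0 hZ]] := hphi s; exists Z.
have [Z hZ] := choice null.
(* The same point of a cell must serve every [s], so it avoids all the finitely many null sets at
   once. *)
have pts (l : {ffun 'I_d -> 'I_m}) : exists x : 'rV[R]_d,
    near_center l x /\ forall s, ~ Z s x.
  apply: null_sets_miss_box => [s|i]; first by have [] := hZ s.
  by have := rad_gt0 R m0; lra.
have [X hX] := choice pts.
have shatter (s : {ffun {ffun 'I_d -> 'I_m} -> bool}) : exists2 f, kan t0 t1 f &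
    forall l, f (X l) != 0 /\ (0 < f (X l)) = s l.
  exists (phi s); first by have [] := hphi s.
  move=> l; have [near notZ] := hX l.
  have [_ /(_ (X l) (near_center_cube m0 near) (notZ s))] := hZ s.
  have := bumps_near_center m0 alpha01 s near; rewrite -/h /= ltr_norml.
  case: (s l) => b1 b2.
    have f0 : 0 < phi s (X l) by lra.
    by rewrite f0 gt_eqF.
  have f0 : phi s (X l) < 0 by lra.
  by rewrite lt_eqF// lt_gtF.
by have := kan_shatter_bound k0 G0 shatter; rewrite card_ffun !card_ord.
Qed.

End LowerBound.

(** * Numerical estimates, from the pattern count to the rate *)

Lemma ln2_ge_half (R : realType) : 2^-1 <= ln 2 :> R.
Proof.
have := @le_ln1Dx R (- 2^-1); rewrite (_ : 1 + - 2^-1 = 2^-1); last by lra.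
by rewrite lnV ?posrE// => H; have := H ltac:(lra); lra.
Qed.

(** After taking logarithms and dividing by the number [W] of parameters, the left side is at most
    [x / 4] plus a multiple of [U * L], where [x = M / W] is at least [64 * (U * L)]; the right side
    is at least [x / 2]. *)
Lemma count_bound (R : realType) (d N P M : nat) :
  (0 < d)%N -> (0 < N)%N -> (0 < P)%N ->
  64 * (N%:R * P%:R * (d%:R + 1) * (d%:R + N%:R + 1) * ln ((d%:R + 1) * P%:R))
    <= M%:R :> R ->
  ((64 * (N * M ^ 2 * P ^ 2)) ^ (N * P * d.+1) < 2 ^ M)%N.
Proof.
move=> d0 N0 P0; set L := ln _; set U := d%:R + N%:R + 1 => hM.
have dR : 1 <= d%:R :> R by rewrite (ler_nat _ 1).
have NR : 1 <= N%:R :> R by rewrite (ler_nat _ 1).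
have PR : 1 <= P%:R :> R by rewrite (ler_nat _ 1).
have ln2 := ln2_ge_half R.
have L2 : ln 2 <= L by rewrite /L ler_ln ?posrE//; nra.
have LP : ln P%:R <= L by rewrite /L ler_ln ?posrE//; nra.
pose W : R := N%:R * P%:R * (d%:R + 1).
have W0 : 0 < W by rewrite !mulr_gt0//; lra.
have U3 : 3 <= U by rewrite /U; lra.
have UL : 0 < U * L by rewrite mulr_gt0//; lra.
have M0 : (0 : R) < M%:R by apply: lt_le_trans hM; rewrite !mulr_gt0//; lra.
(* the number of points per network parameter *)
pose x := M%:R / W.
have Mx : M%:R = x * W by rewrite /x mulfVK// gt_eqF.
have x_ge : 64 * (U * L) <= x.
  by rewrite /x ler_pdivlMr//; apply: le_trans hM; rewrite /W; lra.
have x0 : 0 < x by rewrite divr_gt0.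
clearbody x.
(* The factor [U] absorbs [ln N], which is at most [N - 1], because [L] is at least [2^-1]. *)
have lnN : ln N%:R <= 2 * (U * L).
  have := @le_ln1Dx R (N%:R - 1); rewrite (addrC 1) subrK => H.
  have {}H := H ltac:(lra).
  have : U * 2^-1 <= U * L by rewrite ler_wpM2l//; lra.
  by rewrite /U in U3 *; lra.
(* Scaling by 8 before using the tangent bound of the logarithm gives slope [1 / 8]; the cost
   [3 * ln 2] goes into [U * L]. *)
have lnx : ln x <= x / 8 + U * L.
  have -> : x = x / 8 * 2 ^+ 3 by rewrite -natrX mulfVK// pnatr_eq0.
  rewrite lnM ?posrE ?exprn_gt0 ?divr_gt0// lnXn//.
  have := @le_ln1Dx R (x / 8 - 1); rewrite (addrC 1) subrK => H.
  have {}H := H ltac:(have := divr_gt0 x0 (ltr0n _ 8); lra).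
  have : 3 * L <= U * L by rewrite ler_wpM2r//; lra.
  rewrite -natrX mulfVK ?pnatr_eq0// -mulr_natl; lra.
have lnMx : ln M%:R = ln x + (ln N%:R + L).
  have -> : M%:R = x * (N%:R * ((d%:R + 1) * P%:R)) by rewrite Mx /W; ring.
  have NR0 : (0 : R) < N%:R by lra.
  have DP0 : (0 : R) < (d%:R + 1) * P%:R by rewrite mulr_gt0//; lra.
  rewrite [ln (x * _)]lnM ?posrE//; last by rewrite mulr_gt0.
  by rewrite [ln (N%:R * _)]lnM ?posrE.
have key : W * (6 * ln 2 + (ln N%:R + 2 * ln M%:R + 2 * ln P%:R)) < M%:R * ln 2.
  rewrite lnMx Mx (_ : x * W * ln 2 = W * (x * ln 2)); last by ring.
  rewrite ltr_pM2l//.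
  have : x * 2^-1 <= x * ln 2 by rewrite ler_wpM2l// ltW.
  have : 3 * L <= U * L by rewrite ler_wpM2r//; lra.
  lra.
have M0n : (0 < M)%N by rewrite -(ltr_nat R).
rewrite -(ltr_nat R) -ltr_ln ?posrE ?ltr0n ?expn_gt0 ?muln_gt0 ?M0n ?N0 ?P0//.
rewrite !natrX !lnXn ?ltr0n ?muln_gt0 ?M0n ?N0 ?P0//.
have -> : (64 * (N * M ^ 2 * P ^ 2))%:R =
    2 ^+ 6 * (N%:R * (M%:R ^+ 2 * P%:R ^+ 2)) :> R.
  rewrite (natrM R 64) (natrM R (N * M ^ 2)) (natrM R N (M ^ 2)) !natrX.
  by rewrite -[in RHS]natrX -mulrA.
have N0R : (0 : R) < N%:R by lra.
have P0R : (0 : R) < P%:R by lra.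
rewrite lnM ?posrE ?mulr_gt0 ?exprn_gt0// lnM ?posrE ?mulr_gt0 ?exprn_gt0//.
rewrite lnM ?posrE ?exprn_gt0// !lnXn//.
rewrite -[X in X < _]mulr_natl -[X in _ < X]mulr_natl.
have -> : (N * P * d.+1)%:R = W by rewrite !natrM -natr1.
rewrite -!(mulr_natl (ln _)); lra.
Qed.

(** The factors are at most [7 * (N * M * P)] and [5 * (M * P)]; the product 35 is rounded up to the
    power of two 64. *)
Lemma pattern_count_le (N M k G : nat) :
  (0 < N)%N -> (0 < M)%N -> (0 < k)%N -> (0 < G)%N ->
  ((N * M * (G + k.*2)).*2.+1 * (M * k.+1).*2.+1
     <= 64 * (N * M ^ 2 * (G + k - 1) ^ 2))%N.
Proof.
move=> N0 M0 k0 G0; set P := (G + k - 1)%N.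
have P0 : (0 < P)%N by rewrite /P; lia.
have GP : (G + k.*2 <= 3 * P)%N by rewrite /P; lia.
have kP : (k.+1 <= 2 * P)%N by rewrite /P; lia.
clearbody P.
have NMP0 : (0 < N * M * P)%N by rewrite !muln_gt0 N0 M0.
have MP0 : (0 < M * P)%N by rewrite muln_gt0 M0.
have h1 : ((N * M * (G + k.*2)).*2.+1 <= 7 * (N * M * P))%N.
  have : (N * M * (G + k.*2) <= N * M * (3 * P))%N by rewrite leq_mul2l GP orbT.
  by rewrite mulnCA; lia.
have h2 : ((M * k.+1).*2.+1 <= 5 * (M * P))%N.
  have : (M * k.+1 <= M * (2 * P))%N by rewrite leq_mul2l kP orbT.
  by rewrite mulnCA; lia.
apply: leq_trans (leq_mul h1 h2) _.
have -> : (7 * (N * M * P) * (5 * (M * P)) = 35 * (N * M ^ 2 * P ^ 2))%N.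
  by rewrite !expnS !expn0; lia.
by rewrite leq_mul2r orbT.
Qed.

(** With [z] the [d]-th root of [64 * S], rounding gives [z < m <= 2 * z], hence enough cells and a
    half radius of at least [(8 * z)^-1]. The constant 1024 is [2 * 8 * 64]: the prefactor [2^-1],
    and the powers of [8^-1] and 64 bounded below by [8^-1] and [64^-1]. *)
Lemma grid_rate (R : realType) (d m : nat) (alpha S : R) :
  (0 < d)%N -> 0 < alpha <= 1 -> 0 < S -> 1 <= 64 * S ->
  m = (Num.truncn ((64 * S) `^ d%:R^-1)).+1 ->
  64 * S <= (m ^ d)%:R /\
  1024^-1 * S `^ (- (alpha / d%:R)) <= 2^-1 * (bump_radius R m / 2) `^ alpha.
Proof.
move=> d0 /andP[al0 al1] S0 S1; set z := _ `^ _ => mE.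
have dR : 1 <= d%:R :> R by rewrite (ler_nat _ 1).
have z1 : 1 <= z.
  rewrite -[X in X <= _](powRr0 (64 * S)) /z.
  by apply: ler_powR => //; rewrite invr_ge0; lra.
have z0 : 0 < z by lra.
have /andP[mz zm] := truncn_itv (ltW z0).
have mR : m%:R = (Num.truncn z)%:R + 1 :> R by rewrite mE natr1.
split.
  have -> : 64 * S = z ^+ d.
    rewrite -powR_mulrn ?(ltW z0)// /z -powRrM mulVf ?gt_eqF ?powRr1//; lra.
  rewrite natrX lerXn2r ?nnegrE ?ler0n ?(ltW z0)//.
  by rewrite mE ltW.
have m8 : (8 * z)^-1 <= bump_radius R m / 2.
  rewrite /bump_radius -invfM lef_pV2 ?posrE; [lra| |]; lra.
have al0' := ltW al0.
have z80 : 0 < (8 * z)^-1 by rewrite invr_gt0; lra.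
have : (8 * z)^-1 `^ alpha <= (bump_radius R m / 2) `^ alpha.
  by apply: ge0_ler_powR; rewrite ?nnegrE//; lra.
have -> : (8 * z)^-1 `^ alpha = 8^-1 `^ alpha * z `^ (- alpha).
  rewrite invfM powRM ?invr_ge0 ?(ltW z0)//; congr (_ * _).
  by rewrite -(powR_inv1 (ltW z0)) -powRrM mulN1r.
have -> : z `^ (- alpha) = 64 `^ (- (alpha / d%:R)) * S `^ (- (alpha / d%:R)).
  rewrite -powRM ?(ltW S0)// /z -powRrM; congr (_ `^ _).
  by rewrite mulrN mulrC.
have h8 : 8^-1 <= 8^-1 `^ alpha :> R by apply: ger1_powR => //; lra.
have h64 : 64^-1 <= 64 `^ (- (alpha / d%:R)) :> R.
  rewrite -powR_inv1//; apply: ler_powR; first lra.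
  by rewrite lerN2 ler_pdivrMr; lra.
have hS := powR_ge0 S (- (alpha / d%:R)).
have h : 8^-1 * (64^-1 * S `^ (- (alpha / d%:R))) <=
    8^-1 `^ alpha * (64 `^ (- (alpha / d%:R)) * S `^ (- (alpha / d%:R))).
  by rewrite ler_pM ?mulr_ge0 ?ler_wpM2r// invr_ge0.
lra.
Qed.

Theorem theorem2p3 (R : realType) :
  exists C : R, 0 < C /\
  forall (d N : nat) (alpha : R), (0 < d)%N -> (0 < N)%N -> 0 < alpha <= 1 ->
  forall (f : 'rV[R]_d -> R)
         (phi0 : 'I_N -> 'I_d -> R -> R) (phi1 : 'I_N -> R -> R),
    {within cube R d, continuous f} ->
    (forall x, cube R d x -> f x = two_layer phi0 phi1 x) ->
  forall k G : nat, (0 < k)%N -> (0 < G)%N ->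
  forall (t0 : 'I_N -> 'I_d -> (G + k.*2).-tuple R)
         (t1 : 'I_N -> (G + k.*2).-tuple R),
    (forall j i, sorted <=%R (t0 j i)) -> (forall j, sorted <=%R (t1 j)) ->
  let P := (G + k - 1)%N in
  let A := kan t0 t1 in
  (exists phi : 'rV[R]_d -> R, A phi) /\
  ((C * (N%:R * P%:R * (d%:R + 1) * (d%:R + N%:R + 1)
         * ln ((d%:R + 1) * P%:R)) `^ (- (alpha / d%:R)))%:E
     <= best_approx_error alpha A)%E.
Proof.
exists 1024^-1; split; first by rewrite invr_gt0 ltr0n.
move=> d N alpha d0 N0 al01 _ _ _ _ _ k G k0 G0 t0 t1 _ _ P A.
split.
  exists (two_layer (fun (_ : 'I_N) _ _ => 0) (fun _ _ => 0)).
  exists (fun _ _ _ => 0), (fun _ _ => 0).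
  by split=> // *; exists (fun=> 0) => x; rewrite big1// => p _; rewrite mul0r.
set S := (X in X `^ _).
have P0 : (0 < P)%N by rewrite /P; lia.
have dR : 1 <= d%:R :> R by rewrite (ler_nat _ 1).
have NR : 1 <= N%:R :> R by rewrite (ler_nat _ 1).
have PR : 1 <= P%:R :> R by rewrite (ler_nat _ 1).
have S1 : 1 <= S.
  have L2 : 2^-1 <= ln ((d%:R + 1) * P%:R) :> R.
    by apply: le_trans (ln2_ge_half R) _; rewrite ler_ln ?posrE//; nra.
  (* Factor by factor, from [d], [N] and [P] being at least 1. *)
  have : 1 * 1 * 2 * 3 * 2^-1 <= S.
    by rewrite /S !ler_pM ?mulr_ge0//; lra.
  lra.
(* Fine enough for the grid to have at least [64 * S] cells, the number of points that [count_bound]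
   asks for. *)
pose m := (Num.truncn ((64 * S) `^ d%:R^-1)).+1.
have [||m_ge rate] := @grid_rate R d m alpha S d0 al01 _ _ erefl; [lra|lra|].
apply: le_trans (best_approx_error_ge t0 t1 k0 G0 al01 (ltn0Sn _ : 0 < m)%N _).
  by rewrite lee_fin.
apply: leq_ltn_trans (count_bound d0 N0 P0 m_ge).
by rewrite leq_exp2r ?muln_gt0 ?N0 ?P0// pattern_count_le// expn_gt0.
Qed.
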